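(* Let $Q(\cdot)$ be a commutative generalized Moufang loop with respect to a mapping $\alpha$ of $Q$ onto itself. Suppose that $Q$ is an IP loop, that $Q$ has the universal $\alpha$-elasticity property, and that $(y^{\alpha})^{2}\in N_{\rho}$ for all $y\in Q$. Then $Q$ is associative.
   Context: A loop $(Q,\cdot)$ is a quasigroup with a two-sided identity element $e$; $b\backslash a$ denotes the unique $u$ with $b\cdot u=a$, and $a/b$ the unique $v$ with $v\cdot b=a$. For a mapping $\alpha$ of $Q$ onto itself, $y^{\alpha}$ denotes the image of $y$ under $\alpha$. A loop $Q$ is a generalized Moufang loop (with respect to $\alpha$) if $((x\cdot y)\cdot z)\cdot y^{\alpha}=x\cdot(y\cdot(z\cdot y^{\alpha}))$ for all $x,y,z\in Q$. Denote by $x^{\lambda},x^{\rho}$ the left and right inverses of $x$ ($x^{\lambda}\cdot x=e=x\cdot x^{\rho}$). $Q$ is an IP (inverse property) loop if it has both the left inverse property $x^{\lambda}\cdot(x\cdot y)=y$ and the right inverse property $(y\cdot x)\cdot x^{\rho}=y$ for all $x,y\in Q$. The $\alpha$-elasticity identity is $(y\cdot z)\cdot y^{\alpha}=y\cdot(z\cdot y^{\alpha})$ for all $y,z\in Q$. The principal isotopes of $(Q,\cdot)$ are the loops $(Q,\circ)$ with $x\circ y=(x/a)\cdot(b\backslash y)$, for $a,b\in Q$. $Q$ has universal $\alpha$-elasticity if the $\alpha$-elasticity identity (with the same map $\alpha$ on the set $Q$) holds in $(Q,\cdot)$ and in each of its principal isotopes. The right nucleus is $N_\rho=\{z\in Q: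 x\cdot(y\cdot z)=(x\cdot y)\cdot z\ \forall x,y\in Q\}$. *)

(* Defs.v *)
From HB Require Import structures.
From mathcomp Require Import ssreflect ssrfun ssrbool monoid.

Set Implicit Arguments.
Unset Strict Implicit.
Unset Printing Implicit Defensive.

Local Open Scope group_scope.

(* [ldiv b a] is b\a and [rdiv a b] is a/b: [ldivP] and [rdivP] say that they
   are the unique solutions u, v of b * u = a and v * b = a. *)
HB.mixin Record isLoop Q of BaseUMagma Q := {
  ldiv : Q -> Q -> Q;
  rdiv : Q -> Q -> Q;
  ldivP : forall a b u : Q, b * u = a <-> u = ldiv b a;
  rdivP : forall a b v : Q, v * b = a <-> v = rdiv a b;
  loop_mul1x : left_id (1 : Q) *%g;
  loop_mulx1 : right_id (1 : Q) *%g
}.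

#[short(type="loopType")]
HB.structure Definition Loop := { Q of isLoop Q & BaseUMagma Q }.

(* The principal isotope of Q at a, b: the same carrier, with product
   (x/a) * (b\y); its identity element is b * a. *)
Definition isotope (Q : loopType) (a b : Q) : Type := Q.

Section IsotopeLoop.
Variables (Q : loopType) (a b : Q).

Definition isotope_mul (x y : Q) : Q := rdiv x a * ldiv b y.
Definition isotope_one : Q := b * a.
Definition isotope_ldiv (x y : Q) : Q := b * ldiv (rdiv x a) y.
Definition isotope_rdiv (x y : Q) : Q := rdiv x (ldiv b y) * a.

Lemma isotope_ldivP x y u : isotope_mul y u = x <-> u = isotope_ldiv y x.
Proof.
rewrite /isotope_mul /isotope_ldiv; split=> [/ldivP <-|->].
  by apply/esym; apply: (iffRL (ldivP u b _)).
by apply/ldivP; apply/esym/ldivP.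
Qed.

Lemma isotope_rdivP x y v : isotope_mul v y = x <-> v = isotope_rdiv x y.
Proof.
rewrite /isotope_mul /isotope_rdiv; split=> [/rdivP <-|->].
  by apply/esym; apply: (iffRL (rdivP v a _)).
by apply/rdivP; apply/esym/rdivP.
Qed.

Lemma isotope_mul1x : left_id isotope_one isotope_mul.
Proof.
move=> x; rewrite /isotope_mul /isotope_one.
have <- : b = rdiv (b * a) a by apply/rdivP.
by apply/ldivP.
Qed.

Lemma isotope_mulx1 : right_id isotope_one isotope_mul.
Proof.
move=> x; rewrite /isotope_mul /isotope_one.
have <- : a = ldiv b (b * a) by apply/ldivP.
by apply/rdivP.
Qed.

HB.instance Definition _ := hasMul.Build (isotope a b) isotope_mul.
HB.instance Definition _ := hasOne.Build (isotope a b) isotope_one.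
HB.instance Definition _ := isLoop.Build (isotope a b)
  isotope_ldivP isotope_rdivP isotope_mul1x isotope_mulx1.

End IsotopeLoop.

Section LoopProperties.
Variable Q : loopType.

Definition linv (x : Q) : Q := rdiv 1 x.
Definition rinv (x : Q) : Q := ldiv x 1.

Definition generalized_moufang (alpha : Q -> Q) : Prop :=
  forall x y z : Q, ((x * y) * z) * alpha y = x * (y * (z * alpha y)).

Definition left_inverse_property : Prop :=
  forall x y : Q, linv x * (x * y) = y.

Definition right_inverse_property : Prop :=
  forall x y : Q, (y * x) * rinv x = y.

Definition IP_loop : Prop := left_inverse_property /\ right_inverse_property.

Definition elastic (alpha : Q -> Q) : Prop :=
  forall y z : Q, (y * z) * alpha y = y * (z * alpha y).

Definition right_nucleus (z : Q) : Prop :=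
  forall x y : Q, x * (y * z) = (x * y) * z.

End LoopProperties.

Arguments IP_loop Q : clear implicits.

Definition universally_elastic (Q : loopType) (alpha : Q -> Q) : Prop :=
  elastic alpha /\ forall a b : Q, @elastic (isotope a b) alpha.

(* Main.v *)
Require Import Defs.
From mathcomp Require Import ssreflect ssrfun ssrbool monoid.

Local Open Scope group_scope.

(** Write [L_x] for the translation by [x]; a commutative loop is associative as
    soon as any two translations commute.  Since [alpha] is onto, the hypothesis
    on squares makes every square right nuclear; by commutativity a square then
    moves through any product, so its translation commutes with all others.  With
    the left inverse property this also gives the alternative law
    [L_u L_u = L_(u u)] ([square_alternative]).

    Read as an identity between functions of [z], the generalized Moufang law is
    [L_(alpha y) L_(x y) = L_x L_y L_(alpha y)]: the operator [L_x L_y] is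
    conjugate to [L_(x y)].  Hence its square is conjugate to
    [L_(x y) L_(x y) = L_((x y) (x y))]; as this operator is central, conjugation
    does nothing, and [(L_x L_y)^2 = L_((x y) (x y))]
    ([double_translation_square]).  Evaluating at [y x] gives
    [(x y) (x y) = (x x) (y y)] ([square_mul]), so
    [L_x L_y L_x L_y = L_x L_x L_y L_y], and cancellation leaves
    [L_y L_x = L_x L_y]. *)

Section Loops.
Variable Q : loopType.
Implicit Types a b x y z : Q.

Lemma ldivK a b : a * ldiv a b = b.
Proof. exact: (iffRL (ldivP b a _)). Qed.

Lemma loop_mulI a x y : a * x = a * y -> x = y.
Proof. by move=> /ldivP->; apply/esym/ldivP. Qed.

Hypothesis mulC : commutative (fun x y : Q => x * y).

Lemma nuclear_mulCA s x y : right_nucleus s -> x * (s * y) = s * (x * y).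
Proof. by move=> ns; rewrite (mulC s y) ns (mulC s). Qed.

Lemma nuclear_mulA s x y : right_nucleus s -> s * x * y = s * (x * y).
Proof. by move=> ns; rewrite mulC nuclear_mulCA // (mulC y). Qed.

(** The left inverse property gives [y = s * linv y] with [s = y * y]; once [s]
    is moved out of [y * (y * x)], the factors [linv y] and [y] cancel. *)
Lemma square_alternative y x : left_inverse_property Q ->
  right_nucleus (y * y) -> y * (y * x) = y * y * x.
Proof.
move=> lip ns; rewrite -{1}(lip y y) (mulC (linv y)) nuclear_mulA //.
by rewrite lip.
Qed.

Hypothesis lip : left_inverse_property Q.
Hypothesis nuclear_square : forall x, right_nucleus (x * x).
Variable alpha : Q -> Q.
Hypothesis moufang : generalized_moufang alpha.

Lemma moufang_conjugation x y z :
  alpha y * (x * y * z) = x * (y * (alpha y * z)).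
Proof. by rewrite mulC moufang (mulC z). Qed.

Lemma double_translation_square x y v :
  x * (y * (x * (y * v))) = x * y * (x * y) * v.
Proof.
rewrite -(ldivK (alpha y) v) -!moufang_conjugation square_alternative //.
exact: nuclear_mulCA.
Qed.

Lemma square_mul x y : x * y * (x * y) = x * x * (y * y).
Proof.
(* At [v = y * x] both sides of [double_translation_square] are multiples of
   [x * y], and this factor cancels. *)
apply: (@loop_mulI (x * y)); rewrite mulC [X in _ * X = _]mulC.
rewrite -double_translation_square square_alternative //.
rewrite (nuclear_mulCA (y * y)) // (mulC (y * y)).
by rewrite !nuclear_square.
Qed.

Lemma loop_mulCA x y w : y * (x * w) = x * (y * w).
Proof.
rewrite -(ldivK y w); apply: (@loop_mulI x).
rewrite double_translation_square square_mul nuclear_mulA //.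
by rewrite -!square_alternative.
Qed.

End Loops.

Theorem theorem5p1 (Q : loopType) (alpha : Q -> Q)
    (alpha_onto : forall y : Q, exists x : Q, alpha x = y)
    (Q_comm : commutative (fun x y : Q => x * y))
    (Q_moufang : generalized_moufang alpha)
    (Q_IP : IP_loop Q)
    (Q_elastic : universally_elastic alpha)
    (Q_square : forall y : Q, right_nucleus (alpha y * alpha y)) :
  associative (fun x y : Q => x * y).
Proof.
have nuclear_square (x : Q) : right_nucleus (x * x).
  by have [y <-] := alpha_onto x; apply: Q_square.
have [lip _] := Q_IP.
move=> x y z; rewrite (Q_comm y z) (Q_comm (x * y)).
exact: (loop_mulCA _ Q_comm lip nuclear_square _ Q_moufang).
Qed.
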